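(* Let $d\ge1$, let $T\subset\mathbb R^2$ be a nondegenerate triangle, let $e$ be an edge of $T$ with endpoints $a,b$, length $|e|$ and unit tangent $t_e=(b-a)/|e|$, and let $u\in\mathcal P_{d+1}(T)$. Let $r(u)\in\mathbb R^{d+2}$ be the Bernstein coefficient vector of $u|_e$ (degree $d+1$) and let $r_t(\nabla u)\in\mathbb R^{d+1}$ be the Bernstein coefficient vector of $(\nabla u\cdot t_e)|_e$ (degree $d$). Then $$r_t(\nabla u)=|e|^{-1}\,\mathsf U_{d+1}\,r(u).$$
   Context: $\mathcal P_m(T)$ is the space of bivariate polynomials of total degree at most $m$. The degree-$m$ Bernstein coefficient vector on $e$ of a polynomial $p$ of degree at most $m$ is the vector $(r_0,\dots,r_m)$ such that $p(a+t(b-a))=\sum_{j=0}^m r_j\binom mj t^j(1-t)^{m-j}$ for $0\le t\le1$. The univariate difference matrix is $\mathsf U_m\in\mathbb R^{m\times(m+1)}$, $(\mathsf U_m r)_j=m(r_{j+1}-r_j)$ for $j=0,\dots,m-1$. *)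

(* Defs.v *)
From HB Require Import structures.
From mathcomp Require Import all_boot all_order all_algebra.
From mathcomp Require Import classical_sets reals.
From mathcomp Require Import mpoly.

Set Implicit Arguments.
Unset Strict Implicit.
Unset Printing Implicit Defensive.

Import Order.TTheory GRing.Theory Num.Theory.

Local Open Scope ring_scope.

Definition enorm (R : realType) (v : 'cV[R]_2) : R :=
  Num.sqrt (\sum_k v k 0 ^+ 2).

(* The two edge vectors issuing from vertex 0 are linearly independent. *)
Definition nondegenerate (R : realType) (v : 'I_3 -> 'cV[R]_2) : bool :=
  row_free (col_mx (v 1 - v 0)^T (v 2 - v 0)^T).

Record triangle (R : realType) := Triangle {
  vertex :> 'I_3 -> 'cV[R]_2;
  triangle_nondegenerate : nondegenerate vertex
}.

(* A polynomial function on a nondegenerate triangle comes from exactly one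
   formal polynomial, so P_m(T) is represented by formal polynomials of total
   degree at most m; [msize] is the total degree plus one (and [msize 0 = 0]). *)
Definition Pm (R : realType) (m : nat) : {pred {mpoly R[2]}} :=
  fun p => (msize p <= m.+1)%N.
Arguments Pm : clear implicits.

Definition peval (R : realType) (p : {mpoly R[2]}) (x : 'cV[R]_2) : R :=
  p.@[fun k => x k 0].

Definition grad (R : realType) (u : {mpoly R[2]}) : 'cV[{mpoly R[2]}]_2 :=
  \col_k u^`M(k).

Definition field_dot (R : realType) (F : 'cV[{mpoly R[2]}]_2) (v : 'cV[R]_2) :
  {mpoly R[2]} := \sum_k v k 0 *: F k 0.

Definition is_bernstein_coef (R : realType) (m : nat) (a b : 'cV[R]_2)
    (p : {mpoly R[2]}) (r : 'cV[R]_m.+1) : Prop :=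
  forall t : R, 0 <= t <= 1 ->
    peval p (a + t *: (b - a)) =
    \sum_(j < m.+1) r j 0 * ('C(m, j)%:R * t ^+ j * (1 - t) ^+ (m - j)).

(* "The" coefficient vector: it exists and is unique as soon as [p \in Pm R m];
   the default value 0 is only reached for polynomials of higher degree. *)
Definition bernstein_coef (R : realType) (m : nat) (a b : 'cV[R]_2)
    (p : {mpoly R[2]}) : 'cV[R]_m.+1 :=
  xget 0 [set r | is_bernstein_coef a b p r]%classic.

Definition diff_mx (R : realType) (m : nat) : 'M[R]_(m, m.+1) :=
  \matrix_(i, j) (m%:R * ((j == i.+1 :> nat)%:R - (j == i :> nat)%:R)).

Lemma diff_mxE (R : realType) (m : nat) (r : 'cV[R]_m.+1) (j : 'I_m) :
  (diff_mx R m *m r) j 0 =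
  m%:R * (r (lift ord0 j) 0 - r (widen_ord (leqnSn m) j) 0).
Proof.
have sum1 (i : 'I_m.+1) (n : nat) : i = n :> nat ->
    \sum_(k < m.+1) (k == n :> nat)%:R * r k 0 = r i 0.
  move=> <-; rewrite (bigD1 i) //= eqxx mul1r big1 ?addr0 // => k ki.
  by rewrite (inj_eq val_inj) (negbTE ki) mul0r.
rewrite mxE -(sum1 (lift ord0 j) j.+1) // -(sum1 (widen_ord _ j) j) //.
rewrite -sumrB big_distrr /=; apply: eq_bigr => k _.
by rewrite mxE -mulrA mulrBl.
Qed.

(* Main.v *)
(** On the line through [a] and [b], [u] becomes the univariate polynomial
    [P(t) = u(a + t (b - a))], with [P' = (grad u . (b - a))(a + t (b - a))].
    Differentiating the Bernstein form of [P] of degree [d + 1] yields, term by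
    term, a Bernstein form of degree [d] with coefficients [U_(d+1) r].  Since
    the Bernstein basis is triangular in the monomial basis, coefficient
    vectors exist and are unique, which identifies both sides. *)
Require Import Defs.
From mathcomp Require Import all_boot all_order all_algebra.
From mathcomp Require Import classical_sets reals mpoly zify.
Set Implicit Arguments.
Unset Strict Implicit.
Unset Printing Implicit Defensive.
Import GRing.Theory Num.Theory.
Local Open Scope ring_scope.

Lemma deriv_exp_1subX (R : comNzRingType) (k : nat) :
  ((1 - 'X) ^+ k : {poly R})^`() = - ((1 - 'X) ^+ k.-1 *+ k).
Proof. by rewrite deriv_exp derivB derivC derivX sub0r mulN1r mulNrn. Qed.

(** The index [j] ranges over all of [nat]: for [j > m] the binomial coefficient is zero, and so is
    the polynomial. The derivative rule for [j.+1] thus covers the top index [j = m] too. *)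
Definition bernstein_poly (R : nzRingType) (m j : nat) : {poly R} :=
  ('X^j * (1 - 'X) ^+ (m - j)) *+ 'C(m, j).

Lemma deriv_bernstein_poly0 (R : comNzRingType) (m : nat) :
  (bernstein_poly R m.+1 0)^`() = - (bernstein_poly R m 0 *+ m.+1).
Proof.
rewrite /bernstein_poly !bin0 !mulr1n !expr0 !mul1r subn0.
by rewrite deriv_exp_1subX subn0.
Qed.

Lemma deriv_bernstein_polyS (R : comNzRingType) (m j : nat) :
  (bernstein_poly R m.+1 j.+1)^`() =
  (bernstein_poly R m j - bernstein_poly R m j.+1) *+ m.+1.
Proof.
rewrite /bernstein_poly subSS derivMn derivM derivXn deriv_exp_1subX -subnS /=.
rewrite mulrN mulrnAl mulrnAr mulrnBl mulrnBl -!mulrnA.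
(* The two terms of the product rule match through [(j+1) C(m+1,j+1) = (m+1) C(m,j)] and
   [(m-j) C(m+1,j+1) = (m+1) C(m,j+1)]. *)
congr (_ *+ _ - _ *+ _); first by rewrite -mul_bin_diag mulnC.
by rewrite [RHS]mulnC (mul_bin_down m.+1) subSS.
Qed.

Definition bernstein_form (R : nzRingType) (m : nat) (r : 'cV[R]_m.+1) :
  {poly R} := \sum_(j < m.+1) r j 0 *: bernstein_poly R m j.

Lemma bernstein_formZ (R : nzRingType) (m : nat) (c : R) (r : 'cV[R]_m.+1) :
  bernstein_form (c *: r) = c *: bernstein_form r.
Proof.
by rewrite scaler_sumr; apply: eq_bigr => j _; rewrite mxE scalerA.
Qed.

(** Summation by parts: the derivative rule puts differences on the basis polynomials, and
    regrouping moves them onto the coefficients. *)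
Lemma deriv_bernstein_form (R : realType) (m : nat) (r : 'cV[R]_m.+2) :
  (bernstein_form r)^`() = bernstein_form (diff_mx R m.+1 *m r).
Proof.
pose B := bernstein_poly R m.
have Bm : B m.+1 = 0 by rewrite /B /bernstein_poly bin_small.
rewrite /bernstein_form raddf_sum.
under [RHS]eq_bigr => j _.
  rewrite diff_mxE mulrC -scalerA scaler_nat scalerBl.
  over.
rewrite sumrB big_ord_recl /= derivZ deriv_bernstein_poly0.
under eq_bigr => j _.
  rewrite derivZ deriv_bernstein_polyS mulrnBl scalerBr.
  over.
rewrite sumrB addrCA; congr (_ + _).
rewrite scalerN -opprD; congr (- _).
(* The two sums differ by an index shift; the surplus last term carries [B m.+1], which is zero. *)
rewrite [in RHS]big_ord_recl big_ord_recr /= -/B Bm mul0rn scaler0 addr0.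
congr (_ *: _ + _); first by congr (r _ 0); apply: val_inj.
by apply: eq_bigr => j _; congr (r _ 0 *: _); apply: val_inj.
Qed.

Definition bernstein_mx (R : nzRingType) (m : nat) : 'M[R]_m.+1 :=
  \matrix_(i, j) (bernstein_poly R m j)`_i.

Lemma coef_bernstein_form (R : comNzRingType) (m : nat) (r : 'cV[R]_m.+1)
    (i : 'I_m.+1) :
  (bernstein_form r)`_i = (bernstein_mx R m *m r) i 0.
Proof.
rewrite coef_sum mxE; apply: eq_bigr => j _.
by rewrite coefZ mxE mulrC.
Qed.

(** Since ['X^j] divides the [j]-th Bernstein polynomial, the matrix is lower triangular; its
    diagonal entries [C(m,i)] are nonzero in characteristic 0. *)
Lemma bernstein_mx_unit (R : numFieldType) (m : nat) :
  bernstein_mx R m \in unitmx.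
Proof.
rewrite unitmxE det_trig; last first.
  by apply/is_trig_mxP => i j ij; rewrite mxE coefMn coefXnM ij mul0rn.
rewrite unitfE; apply/prodf_neq0 => i _.
rewrite mxE coefMn coefXnM ltnn subnn -horner_coef0 horner_exp.
rewrite hornerD hornerN hornerC hornerX subr0 expr1n pnatr_eq0 -lt0n.
by rewrite bin_gt0 -ltnS.
Qed.

Lemma size_bernstein_poly (R : comNzRingType) (m j : nat) :
  (size (bernstein_poly R m j) <= m.+1)%N.
Proof.
have [mj|jm] := ltnP m j; first by rewrite /bernstein_poly bin_small ?size_poly0.
rewrite /bernstein_poly -scaler_nat; apply: leq_trans (size_scale_leq _ _) _.
apply: leq_trans (size_polyMleq _ _) _; rewrite size_polyXn /=.
have s1 : (size (1 - 'X : {poly R})).-1 = 1%N.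
  by rewrite -opprB size_polyN size_XsubC.
apply: leq_trans (leq_add (leqnn j) (size_poly_exp_leq _ _)) _.
by rewrite s1 mul1n addnS subnKC.
Qed.

Lemma bernstein_form_inj (R : numFieldType) (m : nat) :
  injective (@bernstein_form R m).
Proof.
move=> r s rs; apply: (can_inj (mulKmx (bernstein_mx_unit R m))).
by apply/colP => i; rewrite -!coef_bernstein_form rs.
Qed.

Lemma bernstein_form_surj (R : numFieldType) (m : nat) (p : {poly R}) :
  (size p <= m.+1)%N -> exists r : 'cV[R]_m.+1, bernstein_form r = p.
Proof.
move=> sp; exists (invmx (bernstein_mx R m) *m \col_i p`_i).
apply/polyP => k; have [km|mk] := ltnP k m.+1.
  rewrite (coef_bernstein_form _ (Ordinal km)) mulKVmx ?mxE //.
  exact: bernstein_mx_unit.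
rewrite !nth_default ?(leq_trans sp) //.
apply: leq_trans mk; apply: leq_trans (size_sum _ _ _) _.
apply/bigmax_leqP => j _.
exact: leq_trans (size_scale_leq _ _) (size_bernstein_poly _ _ _).
Qed.

Lemma eq_poly_on_unit_interval (R : realFieldType) (p q : {poly R}) :
  (forall t, 0 <= t <= 1 -> p.[t] = q.[t]) -> p = q.
Proof.
move=> pq; apply/eqP; rewrite -subr_eq0; apply/negPn/negP => nz.
(* The distinct points [1/(k+1)] lie in the unit interval, and there are [size (p - q)] of them, one
   more than a nonzero [p - q] can have as roots. *)
pose s := [seq (k.+1%:R : R)^-1 | k <- iota 0 (size (p - q))].
suff /(max_poly_roots nz) : all (root (p - q)) s.
  rewrite size_map size_iota ltnn => uniqs; suff: false by []; apply: uniqs.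
  rewrite map_inj_uniq ?iota_uniq // => k l /invr_inj/eqP.
  by rewrite eqr_nat eqSS => /eqP.
apply/allP => _ /mapP[k _ ->]; rewrite /root hornerD hornerN pq ?subrr //.
by rewrite invr_ge0 ler0n invf_le1 ?ltr0n // ler1n.
Qed.

(** Restriction to the line [a + t v], encoded as a substitution so that it is a ring morphism in
    [p]. *)
Definition line_poly (R : comNzRingType) (n : nat) (a v : 'cV[R]_n)
    (p : {mpoly R[n]}) : {poly R} :=
  mmap polyC (fun k => (a k 0)%:P + v k 0 *: 'X) p.

Lemma horner_line_poly (R : realType) (a v : 'cV[R]_2) (p : {mpoly R[2]})
    (t : R) : (line_poly a v p).[t] = peval p (a + t *: v).
Proof.
rewrite /line_poly /peval mevalE /mmap horner_sum; apply: eq_bigr => m _.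
rewrite hornerM hornerC /mmap1 horner_prod; congr (_ * _).
apply: eq_bigr => k _.
by rewrite horner_exp !hornerE !mxE [t * _]mulrC.
Qed.

Lemma size_line_poly (R : idomainType) (n : nat) (a v : 'cV[R]_n)
    (p : {mpoly R[n]}) (m : nat) :
  (msize p <= m.+1)%N -> (size (line_poly a v p) <= m.+1)%N.
Proof.
move=> sp; rewrite /line_poly /mmap big_seq.
apply: leq_trans (size_sum _ _ _) _; apply/bigmax_leqP_seq => w _ wp.
have {sp wp}wm : (mdeg w <= m)%N.
  by rewrite -ltnS (leq_trans _ sp) // msize_mdeg_lt.
rewrite mul_polyC; apply: leq_trans (size_scale_leq _ _) _.
pose h i := (a i 0)%:P + v i 0 *: 'X.
(* The predecessor of the size is subadditive under products, even when a factor is zero, and is at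
   most 1 for each [h i]. *)
suff: ((size (\prod_(i < n) h i ^+ w i)%R).-1 <= mdeg w)%N.
  by move/leq_trans/(_ wm); case: size.
rewrite mdegE; elim/big_ind2: _ => [|p1 k1 p2 k2 le1 le2|i _].
- by rewrite size_polyC oner_eq0.
- have := size_polyMleq p1 p2; have := leq_add le1 le2.
  move: (size p1) (size p2) => s1 s2; lia.
have := size_poly_exp_leq (h i) (w i).
have : (size (h i) <= 2)%N.
  apply: leq_trans (size_polyD _ _) _; rewrite geq_max.
  rewrite (leq_trans (size_polyC_leq1 _)) // (leq_trans (size_scale_leq _ _)) //.
  by rewrite size_polyX.
move: (size _) (size _) => s1 s2; nia.
Qed.

(** The chain rule, proved algebraically: it holds for constants and variables and is stable under
    products and sums, hence holds for all polynomials. *)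
Lemma deriv_line_poly (R : realType) (a v : 'cV[R]_2) (p : {mpoly R[2]}) :
  (line_poly a v p)^`() = line_poly a v (field_dot (grad p) v).
Proof.
pose L := mmap polyC (fun k => (a k 0)%:P + v k 0 *: 'X) : {mpoly R[2]} -> _.
have LE q : L (field_dot (grad q) v) = \sum_k v k 0 *: L q^`M(k).
  rewrite /field_dot /L raddf_sum; apply: eq_bigr => k _.
  by rewrite mxE /= mmapZ mul_polyC.
pose P q := (L q)^`() = \sum_k v k 0 *: L q^`M(k).
suff: P p by rewrite /P -LE.
have PM q s : P q -> P s -> P (q * s).
  rewrite /P => Pq Ps; rewrite /L rmorphM derivM -/L Pq Ps.
  rewrite mulr_suml mulr_sumr -big_split; apply: eq_bigr => k _ /=.
  by rewrite mderivM /L rmorphD !rmorphM scalerDr -scalerAl -scalerAr.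
have PC c : P c%:MP.
  rewrite /P /L mmapC derivC big1 // => k _.
  by rewrite mderivC raddf0 scaler0.
have PX k : P 'X_k.
  rewrite /P /L mmapX mmap1U derivD derivC derivZ derivX add0r.
  rewrite (bigD1 k) //= big1 ?addr0 => [|i ik]; rewrite mderivX mnm1E.
    by rewrite eqxx scale1r -[X in (X - _)%MM]add0m addmK mpolyX0 rmorph1.
  by rewrite eq_sym (negbTE ik) scale0r raddf0 scaler0.
elim/mpolyind: p => [|c m q _ _ Pq]; first by rewrite -mpolyC0; apply: PC.
have PXm : P 'X_[m].
  rewrite mpolyXE_id; apply: (big_ind P) => [||k _].
  - exact: PC 1.
  - exact: PM.
  elim: (m k) => [|l IHl]; first exact: PC 1.
  by rewrite exprS; apply: PM.
have PcX : P (c *: 'X_[m]) by rewrite -mul_mpolyC; apply: PM.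
rewrite /P /L raddfD derivD -/L PcX Pq -big_split; apply: eq_bigr => k _ /=.
by rewrite mderivD /L raddfD scalerDr.
Qed.

Lemma is_bernstein_coefP (R : realType) (m : nat) (a b : 'cV[R]_2)
    (p : {mpoly R[2]}) (r : 'cV[R]_m.+1) :
  is_bernstein_coef a b p r <->
  bernstein_form r = line_poly a (b - a) p.
Proof.
have bE t : (bernstein_form r).[t] =
    \sum_(j < m.+1) r j 0 * ('C(m, j)%:R * t ^+ j * (1 - t) ^+ (m - j)).
  rewrite horner_sum; apply: eq_bigr => j _.
  by rewrite hornerZ hornerMn !hornerE -mulr_natl !mulrA.
split=> [rP|rE t _]; last by rewrite -bE rE horner_line_poly.
apply: eq_poly_on_unit_interval => t t01.
by rewrite bE horner_line_poly rP.
Qed.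

Lemma bernstein_coef_unique (R : realType) (m : nat) (a b : 'cV[R]_2)
    (p : {mpoly R[2]}) (r : 'cV[R]_m.+1) :
  is_bernstein_coef a b p r -> bernstein_coef m a b p = r.
Proof.
move=> rP; apply: xget_unique => // s /is_bernstein_coefP sE.
by apply: bernstein_form_inj; rewrite sE; apply/esym/is_bernstein_coefP.
Qed.

Lemma bernstein_coefP (R : realType) (m : nat) (a b : 'cV[R]_2)
    (p : {mpoly R[2]}) :
  p \in Pm R m -> is_bernstein_coef a b p (bernstein_coef m a b p).
Proof.
move=> /(size_line_poly a (b - a))/bernstein_form_surj[r rE].
by apply: xgetPex; exists r; apply/is_bernstein_coefP.
Qed.

Theorem lemma4p1 (R : realType) (d : nat) (hd : (1 <= d)%N)
  (T : triangle R) (i j : 'I_3) (hij : i != j)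
  (u : {mpoly R[2]}) (hu : u \in Pm R d.+1) :
  let a := T i in
  let b := T j in
  let len := enorm (b - a) in
  let te := len^-1 *: (b - a) in
  bernstein_coef d a b (field_dot (grad u) te) =
  len^-1 *: (diff_mx R d.+1 *m bernstein_coef d.+1 a b u).
Proof.
(* By uniqueness it suffices that the right-hand side is a coefficient vector, which also shows that
   the left-hand side is not the default value. *)
move=> a b len te; apply: bernstein_coef_unique; apply/is_bernstein_coefP.
rewrite bernstein_formZ -deriv_bernstein_form.
have /is_bernstein_coefP-> := bernstein_coefP a b hu.
(* What remains is linearity of [field_dot] in the direction, as [te] is [len^-1] times [b - a]. *)
rewrite deriv_line_poly -mul_polyC -mmapZ; congr line_poly.
by rewrite /field_dot scaler_sumr; apply: eq_bigr => k _; rewrite /te !mxE scalerA.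
Qed.
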